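(* For all positive integers $a,b$ with $a>b$, $R_2(a(x-y)=bz)=a^2$.
   Context: For a positive integer $N$ let $[N]=\{1,\dots,N\}$. For a linear homogeneous equation $\mathcal{E}$ with integer coefficients and a positive integer $c$, the Rado number $R_c(\mathcal{E})$ is the least positive integer $N$ such that every $c$-coloring of $[N]$ contains a monochromatic solution to $\mathcal{E}$, i.e. a solution whose variables all take values in $[N]$ (not necessarily distinct) having the same color. If no such $N$ exists, $R_c(\mathcal{E})=\infty$.
   Formalization: The formal theorem additionally assumes that a and b are coprime; without this the claim is false, e.g. 4(x-y)=2z is the equation 2(x-y)=z, whose 2-colour Rado number is 4, not 16. *)

(* Defs.v *)
From mathcomp Require Import all_boot all_order all_algebra.
From mathcomp Require Import boolp.

Set Implicit Arguments.
Unset Strict Implicit.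
Unset Printing Implicit Defensive.

Import GRing.Theory.
Local Open Scope ring_scope.

(* The homogeneous equation \sum_i E_i x_i = 0 in k unknowns is given by its
   tuple E of integer coefficients. *)
Definition is_solution (k : nat) (E : k.-tuple int) (x : 'I_k -> nat) : bool :=
  \sum_(i < k) tnth E i * (x i)%:Z == 0.

(* [N] = {1, ..., N} is represented by 'I_N, with i : 'I_N standing for the
   integer i.+1. *)
Definition has_mono_solution (k : nat) (E : k.-tuple int) (c N : nat)
    (chi : {ffun 'I_N -> 'I_c}) : bool :=
  [exists x : {ffun 'I_k -> 'I_N},
     is_solution E (fun i => (x i).+1) &&
     [forall i, forall j, chi (x i) == chi (x j)]].

Definition rado_property (k : nat) (E : k.-tuple int) (c N : nat) : bool :=
  (0 < N)%N && [forall chi : {ffun 'I_N -> 'I_c}, has_mono_solution E chi].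

(* R_c(E); None stands for infinity. *)
Definition rado_number (c k : nat) (E : k.-tuple int) : option nat :=
  match pselect (exists N, rado_property E c N) with
  | left exN => Some (ex_minn exN)
  | right _ => None
  end.

(* a (x - y) = b z, in the unknowns x, y, z in this order. Scaling (a, b) does not
   change the solutions, so statements whose value depends on a and b themselves
   need coprime a b: e.g. 4 (x - y) = 2 z is the equation 2 (x - y) = z. *)
Definition diff_equation (a b : nat) : 3.-tuple int :=
  [tuple a%:Z; - a%:Z; - b%:Z].

Lemma diff_equationP (a b : nat) (x : 'I_3 -> nat) :
  is_solution (diff_equation a b) x <->
  a%:Z * ((x (inord 0))%:Z - (x (inord 1))%:Z) = b%:Z * (x (inord 2))%:Z.
Proof.
have e0 : inord 0 = ord0 :> 'I_3 by apply/val_inj; rewrite /= inordK.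
have e1 : inord 1 = lift ord0 ord0 :> 'I_3 by apply/val_inj; rewrite /= inordK.
have e2 : inord 2 = lift ord0 (lift ord0 ord0) :> 'I_3.
  by apply/val_inj; rewrite /= inordK.
rewrite /is_solution !big_ord_recl big_ord0 e0 e1 e2 !(tnth_nth 0) /=.
rewrite addr0 !mulNr addrA -mulrBr subr_eq0.
by split=> /eqP.
Qed.

Lemma rado_numberP (c k : nat) (E : k.-tuple int) (N : nat) :
  rado_number c E = Some N <->
  rado_property E c N /\ (forall M, rado_property E c M -> (N <= M)%N).
Proof.
rewrite /rado_number; case: pselect => [exN|nexN]; last first.
  by split=> // -[hN _]; case: nexN; exists N.
case: ex_minnP => m hm minm; split=> [[<-]//|[hN minN]].
by congr Some; apply/eqP; rewrite eqn_leq minm //= minN.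
Qed.

(* Main.v *)
(** Since a and b are coprime, the solutions are the triples (y + bk, y, ak).

    Lower bound: colour i by whether a divides i. In a monochromatic solution z
    = ak forces a | x - y = bk, hence a | k and z >= a^2.

    Upper bound: suppose that a colouring of [a^2] has no monochromatic
    solution. The solution (a^2, a(a - b), a^2) shows that a(a - b) and a^2 have
    different colours, so there is a least k <= a for which ak and a have
    different colours; say a is red and ak is blue. On the progression
    f(m) = 1 + bm two red terms are at distance at least k and two blue terms are
    never at distance k. If f(0) is blue, then f(k) is red and f(1), f(k + 1) are
    blue. If f(0) is red, then f(1) is blue, f(k + 1) is red, and f(2), f(k + 2)
    are blue. The term f(k + 2) exceeds a^2 only if k = a and b = a - 1, but then
    f(0) = 1 is blue because of the solution (a, 1, a). *)

Require Import Defs.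
From mathcomp Require Import all_boot all_order all_algebra.
From mathcomp Require Import boolp zify.

Lemma diff_equation_has_mono (a b c N : nat) (chi : {ffun 'I_N -> 'I_c}) :
  has_mono_solution (diff_equation a b) chi <->
  exists x y z : 'I_N, [/\ a * x.+1 = a * y.+1 + b * z.+1,
                           chi x = chi y & chi x = chi z].
Proof.
split.
  case/existsP=> x /andP[/diff_equationP /= sol /forallP mono].
  exists (x (inord 0)), (x (inord 1)), (x (inord 2)); split.
  - by move: sol; move: (x _) (x _) (x _) => u v w; nia.
  - by apply/eqP; have /forallP := mono (inord 0); apply.
  - by apply/eqP; have /forallP := mono (inord 0); apply.
case=> x [y [z [sol xy xz]]].
apply/existsP; exists [ffun i => tnth [tuple x; y; z] i]; apply/andP; split.
  by apply/diff_equationP; rewrite !ffunE !(tnth_nth x) !inordK //=; lia.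
have mono i : chi ([ffun i => tnth [tuple x; y; z] i] i) = chi x.
  by rewrite ffunE (tnth_nth x); case: i => [[|[|[|]]]] //= _.
by apply/forallP=> i; apply/forallP=> j; rewrite !mono.
Qed.

(** The solution meant is (y + bk, y, ak); the bound [k <= a] keeps [a * k] in [a^2]. *)
Lemma two_colouring_mono (a b : nat) (C : nat -> bool) : 0 < b < a ->
  exists y k, [/\ 0 < y, 0 < k <= a, y + b * k <= a ^ 2,
                  C (y + b * k) = C y & C (y + b * k) = C (a * k)].
Proof.
case/andP=> b_gt0 ltba; apply: contrapT => noSol.
have avoid y k : 0 < y -> 0 < k <= a -> y + b * k <= a ^ 2 ->
    ~~ ((C y == C (a * k)) && (C (y + b * k) == C (a * k))).
  move=> y_gt0 k_gt0 le_a2; apply/negP=> /andP[/eqP Cy /eqP Cx].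
  by apply: noSol; exists y, k; split; rewrite // ?Cx ?Cy.
pose differs k := (0 < k <= a) && (C (a * k) != C a).
have ex_differs : exists k, differs k.
  have neq : C (a * (a - b)) != C (a * a).
    have eq_a2 : a * (a - b) + b * a = a * a by nia.
    have := @avoid (a * (a - b)) a; rewrite eq_a2 eqxx andbT; apply; lia || nia.
  have [eqCa|neCa] := C (a * a) =P C a.
    by exists (a - b); rewrite /differs -eqCa neq andbT; lia.
  by exists a; rewrite /differs (introF eqP neCa) andbT; lia.
case: (ex_minnP ex_differs) => k /andP[/andP[k_gt0 le_ka] Ck] kmin.
have k_gt1 : 1 < k.
  rewrite ltn_neqAle k_gt0 andbT eq_sym.
  by apply: contraNneq Ck => ->; rewrite muln1.
have same j : 0 < j < k -> C (a * j) = C a.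
  case/andP=> j_gt0 ltjk; have lt_ja := leq_trans ltjk le_ka.
  apply/eqP; apply: contraTT ltjk => Cj.
  by rewrite -leqNgt; apply: kmin; rewrite /differs Cj; lia.
pose red m := C (1 + b * m) == C a.
(* The third entry of the excluded solution is [a * j], red for 0 < j < k; in [blue_far] it is the
   blue [a * k]. *)
have red_far m j : 0 < j < k -> 1 + b * (m + j) <= a ^ 2 ->
    ~~ (red m && red (m + j)).
  move=> jk le_a2; have := @avoid (1 + b * m) j.
  by rewrite (same _ jk) -addnA -mulnDr; apply=> //; lia.
have blue_far m : 1 + b * (m + k) <= a ^ 2 -> red m || red (m + k).
  move=> le_a2; have := @avoid (1 + b * m) k.
  rewrite -addnA -mulnDr k_gt0 le_ka => /(_ isT isT le_a2); rewrite /red.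
  by move: Ck; do 4!case: (C _).
(* The extreme case is 1 + (a - 1)(a + 1) = a^2. *)
have le_k1 m : m <= k.+1 -> 1 + b * m <= a ^ 2 by nia.
have [r0|b0] := boolP (red 0).
  have le_k2 : 1 + b * k.+2 <= a ^ 2.
    suff : (k < a) || (b.+1 < a) by nia.
    rewrite -[_ || _]negbK negb_or -!leqNgt; apply/negP=> /andP[leak leab].
    have eq_a : 1 + b * 1 = a by lia.
    have := @avoid 1 1; rewrite eq_a muln1 eqxx andbT.
    move: r0; rewrite /red muln0 addn0 => ->.
    by move=> mono; suff : ~~ true by []; apply: mono; nia.
  have b1 : ~~ red 1.
    by have := @red_far 0 1; rewrite r0; apply; [lia | apply: le_k1; lia].
  have r_k1 : red k.+1.
    by have := @blue_far 1; rewrite (negbTE b1) (add1n k); apply; apply: le_k1.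
  have b2 : ~~ red 2.
    (* For k = 2, distance 2 from f(0) is allowed to red terms, but distance 1 from the red f(3) is
       not. *)
    have [k2|k_neq2] := eqVneq k 2.
      have eq3 : 2 + 1 = k.+1 by rewrite k2.
      have := @red_far 2 1; rewrite eq3 r_k1 andbT.
      by apply; [lia | apply: le_k1].
    by have := @red_far 0 2; rewrite r0; apply; [lia | apply: le_k1; lia].
  have b_k2 : ~~ red k.+2.
    by have := @red_far k.+1 1; rewrite r_k1 addn1; apply; [lia | ].
  by have := @blue_far 2; rewrite add2n (negbTE b2) (negbTE b_k2) => /(_ le_k2).
have r_k : red k.
  by have := @blue_far 0; rewrite (negbTE b0); apply; apply: le_k1.
have b1 : ~~ red 1.
  have := @red_far 1 k.-1; rewrite (add1n k.-1) prednK // r_k andbT.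
  by apply; [lia | apply: le_k1].
have b_k1 : ~~ red k.+1.
  by have := @red_far k 1; rewrite r_k addn1; apply; [lia | apply: le_k1].
have := @blue_far 1; rewrite (add1n k) (negbTE b1) (negbTE b_k1).
by move=> /(_ (le_k1 _ (leqnn _))).
Qed.

Theorem theorem3p2 (a b : nat) (ha : (0 < a)%N) (hb : (0 < b)%N)
    (hab : (b < a)%N) (hcop : coprime a b) :
  rado_number 2 (diff_equation a b) = Some (a ^ 2)%N.
Proof.
apply/rado_numberP; split.
  rewrite /rado_property expn_gt0 ha; apply/forallP=> chi.
  apply/diff_equation_has_mono.
  have a2_gt0 : 0 < a ^ 2 by rewrite expn_gt0 ha.
  (* Inverse of the shift [i.+1]; integers outside [a^2] default to the point 1. *)
  pose pt n : 'I_(a ^ 2) := insubd (Ordinal a2_gt0) n.-1.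
  have ptK n : 0 < n <= a ^ 2 -> (pt n).+1 = n.
    by case: n => //= n le_n; rewrite val_insubd /= le_n.
  have bool_inj (i j : 'I_2) : (i == ord0) = (j == ord0) -> i = j.
    by case: i j => [[|[|]] //= ?] [[|[|]] //= ?] _; apply: val_inj.
  have [|y [k [y_gt0 k_gt0 le_a2 eq_xy eq_xz]]] :=
    @two_colouring_mono a b (fun n => chi (pt n) == ord0); first by rewrite hb.
  exists (pt (y + b * k)), (pt y), (pt (a * k)).
  split; [rewrite !ptK; nia | exact: bool_inj | exact: bool_inj].
move=> M /andP[M_gt0 /forallP/(_ [ffun i : 'I_M => inord (a %| i.+1)])].
case/diff_equation_has_mono=> x [y [z [sol]]]; rewrite !ffunE.
move=> /(congr1 val) /= + /(congr1 val) /=; rewrite !inordK ?ltnS ?leq_b1 //.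
have dvd_z : a %| z.+1.
  rewrite -(Gauss_dvdr _ hcop) -(dvdn_addr _ (dvdn_mulr y.+1 (dvdnn a))) -sol.
  exact: dvdn_mulr.
rewrite dvd_z => xy /eqP; rewrite eqb1 => dvd_x.
move: xy; rewrite dvd_x => /esym/eqP; rewrite eqb1 => dvd_y.
(* Here z has the colour of the multiples of a, so a divides x and y, and a^2 divides ax - ay =
   bz. *)
have dvd_bz : a ^ 2 %| b * z.+1.
  rewrite -(dvdn_addr _ (dvdn_mul (dvdnn a) dvd_y)) -sol.
  exact: dvdn_mul.
apply: leq_trans (ltn_ord z); apply: dvdn_leq => //.
by rewrite -(Gauss_dvdr _ (coprimeXl 2 hcop)).
Qed.
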